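(* Let $(d_n)_{n\ge1}$ be a fixed sequence of integers $d_n\ge2$, let $k\ge1$ and $c\in\{0,1,\dots,d_k-1\}$. The Lebesgue measure of the set $\Delta^k_c$ is equal to $\frac{1}{d_k}$.
   Context: Put $a_0=\sum_{n=1}^{\infty}\frac{(-1)^{n+1}}{d_1d_2\cdots d_n}$. For digits $\varepsilon_n\in\{0,\dots,d_n-1\}$ put $\Delta^{-D}_{\varepsilon_1\varepsilon_2\ldots}=\sum_{n=1}^{\infty}\frac{(-1)^n\varepsilon_n}{d_1d_2\cdots d_n}$; every number of $[a_0-1;a_0]$ has such a representation. The set $\Delta^k_c$ is the set of all numbers of $[a_0-1;a_0]$ having a representation $\Delta^{-D}_{\varepsilon_1\varepsilon_2\ldots}$ with $\varepsilon_k=c$. *)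

(* Defs.v *)
From HB Require Import structures.
From mathcomp Require Import all_boot all_order all_algebra.
From mathcomp Require Import all_classical all_reals all_analysis.
Set Implicit Arguments.
Unset Strict Implicit.
Unset Printing Implicit Defensive.
Import Order.TTheory GRing.Theory Num.Theory.
Import numFieldNormedType.Exports.
Local Open Scope classical_set_scope.
Local Open Scope ring_scope.

(* Sequences are indexed from 1: the values d 0 and eps 0 are never used.
   The limits below exist as soon as 2 <= d n and eps n < d n for all
   n >= 1, since the n-th term of the series is then at most
   1 / (d_1 ... d_(n-1)) <= 2^(1-n) in absolute value. *)

Definition base_prod (d : nat -> nat) (n : nat) : nat :=
  (\prod_(1 <= i < n.+1) d i)%N.

Definition a0 (R : realType) (d : nat -> nat) : R :=
  limn (fun N : nat => \sum_(1 <= n < N.+1)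
    ((-1) ^+ n.+1 / (base_prod d n)%:R : R)).

Definition nega_D (R : realType) (d eps : nat -> nat) : R :=
  limn (fun N : nat => \sum_(1 <= n < N.+1)
    ((-1) ^+ n * (eps n)%:R / (base_prod d n)%:R : R)).

Definition digits (d eps : nat -> nat) : Prop :=
  forall n, (1 <= n)%N -> (eps n < d n)%N.

(* Some numbers have two representations; it suffices that one of them has
   c as its k-th digit. *)
Definition Delta_set (R : realType) (d : nat -> nat) (k c : nat) : set R :=
  [set x | a0 R d - 1 <= x <= a0 R d /\
     exists eps : nat -> nat,
       [/\ digits d eps, eps k = c & x = nega_D R d eps]].

(* Main.v *)
Require Import Defs.
From mathcomp Require Import all_boot all_order all_algebra.
From mathcomp Require Import all_classical all_reals all_analysis.
From mathcomp Require Import zify ring lra.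
Import Order.TTheory GRing.Theory Num.Theory.
Import numFieldNormedType.Exports.
Local Open Scope classical_set_scope.
Local Open Scope ring_scope.

(** Write D_n = d_1 ... d_n. Replacing each odd-indexed digit e_n by
    d_n - 1 - e_n turns the alternating series into a translate of the positive
    Cantor series: since (d_n - 1) / D_n = 1 / D_(n-1) - 1 / D_n, the terms that
    do not depend on the digits add up to a_0 - 1, so that
    [nega_D d e = a_0 - 1 + sum_n e'_n / D_n] with flipped digits e'
    ([nega_D_cantor]). As flipping is an involution on digit sequences,
    Delta^k_c is the translate by a_0 - 1 of the set of sums of Cantor series
    with k-th digit c', where c' is c or d_k - 1 - c according to the parity
    of k.

    The sums of Cantor series whose first k digits are prescribed form a closed
    interval [m / D_k, (m + 1) / D_k], where m is the integer with those digits
    in mixed radix. Fixing only the k-th digit leaves m = j d_k + c' with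
    0 <= j < D_(k-1) ([cantor_digit_set]). This gives D_(k-1) intervals of
    length 1 / D_k whose left endpoints are 1 / D_(k-1) apart; as d_k >= 2 they
    are pairwise disjoint, and their total length is D_(k-1) / D_k = 1 / d_k. *)

(** The N-th partial sum of the positive Cantor series sum_n e_n / D_n. *)
Definition cantor_sum (R : realType) (d e : nat -> nat) (N : nat) : R :=
  \sum_(1 <= n < N.+1) (e n)%:R / (base_prod d n)%:R.

(** The sum of the Cantor series; meaningful when e is a digit sequence. *)
Definition cantor (R : realType) (d e : nat -> nat) : R :=
  limn (cantor_sum R d e).

(** The integer with mixed-radix digits e_1 ... e_n, e_1 being the most
    significant one. *)
Fixpoint prefix_int (d e : nat -> nat) (n : nat) : nat :=
  if n is m.+1 then (prefix_int d e m * d n + e n)%N else 0%N.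

(** The digits of odd index are reflected in {0, ..., d_n - 1}; those of even
    index are kept. *)
Definition flip_odd (d e : nat -> nat) (n : nat) : nat :=
  if odd n then ((d n).-1 - e n)%N else e n.

(** The interval [m / D_k, (m + 1) / D_k] translated by a, where m = j d_k + c is
    the integer whose k-th digit is c and whose first k - 1 digits encode j. *)
Definition cylinder (R : realType) (d : nat -> nat) (k c : nat) (a : R)
    (j : nat) : set R :=
  let m := (j * d k + c)%N in
  `[a + m%:R / (base_prod d k)%:R, a + m.+1%:R / (base_prod d k)%:R].

(** * Positive Cantor series *)

Section CantorSeries.
Variables (R : realType) (d : nat -> nat).
Hypothesis hd : forall n : nat, (1 <= n)%N -> (2 <= d n)%N.

Local Notation D n := (base_prod d n).

Lemma base_prod0 : D 0 = 1%N.
Proof. by rewrite /base_prod big_geq. Qed.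

Lemma base_prodS n : D n.+1 = (D n * d n.+1)%N.
Proof. by rewrite /base_prod big_nat_recr. Qed.

Lemma base_prod_gt n : (n < D n)%N.
Proof.
elim: n => [|n IHn]; first by rewrite base_prod0.
by rewrite base_prodS; have := hd n.+1 isT; nia.
Qed.

Lemma base_prod_gt0 n : (0 < D n)%N.
Proof. exact: leq_ltn_trans (base_prod_gt n). Qed.

Lemma base_prodR_gt0 n : 0 < (D n)%:R :> R.
Proof. by rewrite ltr0n base_prod_gt0. Qed.

Lemma base_prodR_neq0 n : (D n)%:R != 0 :> R.
Proof. by rewrite gt_eqF ?base_prodR_gt0. Qed.

Lemma digit_base_neq0 n : (d n.+1)%:R != 0 :> R.
Proof. by rewrite pnatr_eq0; have := hd n.+1 isT; lia. Qed.

Lemma cvg_base_prodV : ((D n)%:R^-1 : R) @[n --> \oo] --> 0.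
Proof.
apply: (@squeeze_cvgr _ _ _ _ (fun=> 0) (@harmonic R)); last 2 first.
- exact: cvg_cst.
- exact: cvg_harmonic.
near=> n; rewrite invr_ge0 ler0n/= /harmonic lef_pV2 ?posrE ?base_prodR_gt0 ?ltr0n//.
by rewrite ler_nat base_prod_gt.
Unshelve. all: by end_near. Qed.

Lemma cantor_sum_prefix e n : cantor_sum R d e n = (prefix_int d e n)%:R / (D n)%:R.
Proof.
elim: n => [|n IHn]; first by rewrite /cantor_sum big_geq//= mul0r.
rewrite /cantor_sum big_nat_recr//= -/(cantor_sum R d e n) IHn base_prodS.
rewrite natrD !natrM.
by field; rewrite base_prodR_neq0 digit_base_neq0.
Qed.

Lemma prefix_lt e n : digits d e -> (prefix_int d e n < D n)%N.
Proof.
move=> he; elim: n => [|n IHn] /=; first by rewrite base_prod0.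
by rewrite base_prodS; have := he n.+1 isT; nia.
Qed.

Lemma cantor_sum_nondecreasing e : nondecreasing_seq (cantor_sum R d e).
Proof.
apply/nondecreasing_seqP => n; rewrite [leRHS]/cantor_sum big_nat_recr//=.
by rewrite lerDl divr_ge0.
Qed.

Lemma cantor_sum_upper_nonincreasing e : digits d e ->
  nonincreasing_seq (fun n => cantor_sum R d e n + (D n)%:R^-1).
Proof.
move=> he; apply/nonincreasing_seqP => n.
rewrite !cantor_sum_prefix /= base_prodS.
rewrite -[X in _ + X <= _]div1r -[X in _ <= _ + X]div1r -!mulrDl.
have -> : ((prefix_int d e n)%:R + 1) / (D n)%:R =
   ((prefix_int d e n)%:R + 1) * (d n.+1)%:R / (D n * d n.+1)%:R :> R.
  by rewrite natrM; field; rewrite base_prodR_neq0 digit_base_neq0.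
rewrite ler_pM2r ?invr_gt0 -?base_prodS ?base_prodR_gt0//.
rewrite !natr1 -natrM ler_nat.
by have := he n.+1 isT; nia.
Qed.

Lemma cvg_cantor_sum e : digits d e -> cantor_sum R d e n @[n --> \oo] --> cantor R d e.
Proof.
move=> he; apply: nondecreasing_is_cvgn; first exact: cantor_sum_nondecreasing.
exists 1 => _ [n _ <-].
rewrite (@le_trans _ _ (cantor_sum R d e n + (D n)%:R^-1))//.
  by rewrite lerDl invr_ge0.
rewrite (le_trans (cantor_sum_upper_nonincreasing e he 0%N n (leq0n n)))//.
by rewrite /cantor_sum big_geq// base_prod0 invr1 add0r.
Qed.

Lemma cantor_enclosure e n : digits d e ->
  cantor_sum R d e n <= cantor R d e <= cantor_sum R d e n + (D n)%:R^-1.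
Proof.
move=> he; have hc := cvg_cantor_sum e he.
apply/andP; split.
  by apply: nondecreasing_cvgn_le; [exact: cantor_sum_nondecreasing|apply: cvgP hc].
have hu : cantor_sum R d e n + (D n)%:R^-1 @[n --> \oo] --> cantor R d e.
  by rewrite -[X in _ --> X]addr0; apply: cvgD hc cvg_base_prodV.
rewrite -(cvg_lim _ hu)//; apply: (nonincreasing_cvgn_ge _ _ n).
  exact: cantor_sum_upper_nonincreasing.
exact: cvgP hu.
Qed.

(** If F_n are nested mixed-radix prefixes with F_n / D_n within 1 / D_n below x,
    then the last digits of the F_n are the digits of x. *)
Lemma cantor_digitsE (F : nat -> nat) (x : R) : F 0%N = 0%N ->
    (forall n, (F n.+1 %/ d n.+1)%N = F n) ->
    (forall n, (F n)%:R <= x * (D n)%:R <= (F n).+1%:R) ->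
  cantor R d (fun n => F n %% d n)%N = x.
Proof.
move=> F0 Fdiv Fx.
have prefixE n : prefix_int d (fun n => F n %% d n)%N n = F n.
  by elim: n => [|n IHn] //=; rewrite IHn -(Fdiv n) -divn_eq.
apply: cvg_lim => //.
apply: (@squeeze_cvgr _ _ _ _ (fun n => x - (D n)%:R^-1) (fun=> x)).
- near=> n; have /andP[lex gex] := Fx n.
  rewrite cantor_sum_prefix prefixE lerBlDr -[X in _ + X]div1r -mulrDl natr1.
  by rewrite ler_pdivlMr ?ler_pdivrMr ?base_prodR_gt0// gex.
- by rewrite -[X in _ --> X]subr0; apply: cvgB cvg_base_prodV; exact: cvg_cst.
- exact: cvg_cst.
Unshelve. all: by end_near. Qed.

Lemma digits_mod (F : nat -> nat) : digits d (fun n => F n %% d n)%N.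
Proof. by move=> n n1; rewrite ltn_mod; have := hd n n1; lia. Qed.

(** * Cantor series with a prescribed digit *)

Lemma cantor_mem_cylinder e k : digits d e ->
  cylinder R d k.+1 (e k.+1) 0 (prefix_int d e k) (cantor R d e).
Proof.
move=> he; have := cantor_enclosure e k.+1 he.
rewrite /cylinder /= in_itv/= !add0r cantor_sum_prefix.
by rewrite -[X in _ <= _ + X]div1r -mulrDl natr1.
Qed.

(** The right endpoint x = q / D_(k+1) of a cylinder needs the expansion that ends
    in maximal digits, whose prefixes are the ceilings of x D_n minus 1. *)
Lemma cylinder_cantor_right k j c : (c < d k.+1)%N -> (j < D k)%N ->
  exists e, [/\ digits d e, e k.+1 = c &
    (j * d k.+1 + c).+1%:R / (D k.+1)%:R = cantor R d e].
Proof.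
move=> ck jk; set q := (j * d k.+1 + c).+1.
(* This is the ceiling of q D_n / D_(k+1), minus 1. *)
pose F n := ((q * D n).-1 %/ D k.+1)%N.
have q_gt0 n : (0 < q * D n)%N by rewrite muln_gt0 base_prod_gt0.
have Dk := base_prod_gt0 k.+1.
have qle : (q <= D k.+1)%N by rewrite base_prodS /q; nia.
have d_gt0 n : (0 < d n.+1)%N by have := hd n.+1 isT; lia.
exists (fun n => F n %% d n)%N; split; first exact: digits_mod.
  rewrite /F; have -> : (q * D k.+1).-1 = (q.-1 * D k.+1 + (D k.+1).-1)%N.
    by rewrite /q /=; nia.
  rewrite divnMDl// divn_small ?addn0; last by rewrite prednK.
  by rewrite /q /= modnMDl modn_small.
rewrite (@cantor_digitsE F (q%:R / (D k.+1)%:R))//.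
- by rewrite /F base_prod0 muln1 divn_small// /q.
- move=> n; rewrite /F divnAC; congr (_ %/ _)%N.
  rewrite base_prodS mulnA.
  have -> : (q * D n * d n.+1).-1 = ((q * D n).-1 * d n.+1 + (d n.+1).-1)%N.
    by have := q_gt0 n; have := d_gt0 n; nia.
  by rewrite divnMDl// divn_small ?addn0// prednK.
- move=> n; rewrite mulrAC ler_pdivlMr ?base_prodR_gt0//.
  rewrite ler_pdivrMr ?base_prodR_gt0// -!natrM !ler_nat.
  have := divn_eq (q * D n).-1 (D k.+1); have := ltn_pmod (q * D n).-1 Dk.
  by have := q_gt0 n; rewrite -/(F n); lia.
Qed.

(** Elsewhere in the cylinder the prefixes are the integer parts of x D_n. *)
Lemma cylinder_cantor_interior k j c (x : R) : (c < d k.+1)%N -> (j < D k)%N ->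
    (j * d k.+1 + c)%:R / (D k.+1)%:R <= x < (j * d k.+1 + c).+1%:R / (D k.+1)%:R ->
  exists e, [/\ digits d e, e k.+1 = c & x = cantor R d e].
Proof.
move=> ck jk; rewrite ler_pdivrMr ?base_prodR_gt0// ltr_pdivlMr ?base_prodR_gt0//.
move=> xk.
pose F n := Num.truncn (x * (D n)%:R).
have Dk := base_prodR_gt0 k.+1.
have x0 : 0 <= x.
  by case/andP: xk => xk _; rewrite -(pmulr_lge0 _ Dk) (le_trans _ xk).
have xD n : 0 <= x * (D n)%:R by rewrite mulr_ge0.
have d_gt0 n : (0 < d n.+1)%N by have := hd n.+1 isT; lia.
have Fdiv n : (F n.+1 %/ d n.+1)%N = F n.
  apply/eqP; rewrite eqn_leq /F -ltnS ltn_divLR// leq_divRL//.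
  rewrite truncn_ge_nat// truncn_lt_nat// base_prodS !natrM mulrA.
  by rewrite ltr_pM2r ?ler_pM2r ?ltr0n// andbC; exact: truncn_itv.
have Fk : F k.+1 = (j * d k.+1 + c)%N by exact: truncn_def.
have x1 : x < 1.
  case/andP: xk => _ xk; rewrite -(ltr_pM2r Dk) (lt_le_trans xk)// mul1r ler_nat.
  by rewrite base_prodS; nia.
exists (fun n => F n %% d n)%N; split; first exact: digits_mod.
  by rewrite Fk modnMDl modn_small.
rewrite (@cantor_digitsE F x)//.
  by rewrite /F base_prod0 mulr1; apply: truncn_def; rewrite x0.
by move=> n; have /andP[-> /ltW->] := truncn_itv (xD n).
Qed.

Lemma cantor_digit_set k c : (c < d k.+1)%N ->
  [set x : R | exists e, [/\ digits d e, e k.+1 = c & x = cantor R d e]] =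
  \bigcup_(j in `I_(D k)) cylinder R d k.+1 c 0 j.
Proof.
move=> ck; apply/seteqP; split => x /=.
  move=> [e [he <- ->]]; exists (prefix_int d e k); first exact: prefix_lt.
  exact: cantor_mem_cylinder.
move=> [j /= jk]; rewrite /cylinder /= !add0r in_itv /= => /andP[jx].
rewrite le_eqVlt => /orP[/eqP ->|xj]; first exact: cylinder_cantor_right.
by apply: cylinder_cantor_interior ck jk _; rewrite jx.
Qed.

(** * Reduction of the alternating series *)

Lemma digits_flip_odd e : digits d e -> digits d (flip_odd d e).
Proof. by move=> he n n1; have := he n n1; rewrite /flip_odd; case: ifP; lia. Qed.

Lemma flip_oddK e : digits d e -> flip_odd d (flip_odd d e) = e.
Proof.
move=> he; apply/funext => -[|n] //; rewrite /flip_odd.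
by have := he n.+1 isT; case: (odd n.+1); lia.
Qed.

(** The finite form of the reduction; the boundary term 1 / D_N
    is present for even N only. *)
Lemma alternating_sum_flip e N : digits d e ->
  \sum_(1 <= n < N.+1) ((-1) ^+ n * (e n)%:R / (D n)%:R : R) =
  \sum_(1 <= n < N.+1) ((-1) ^+ n.+1 / (D n)%:R : R) - 1
    + (~~ odd N)%:R / (D N)%:R + cantor_sum R d (flip_odd d e) N.
Proof.
move=> he; elim: N => [|N IHN].
  by rewrite /cantor_sum !big_geq// base_prod0 divr1 sub0r addr0 addNr.
rewrite /cantor_sum !(big_nat_recr N.+1)//= IHN -/(cantor_sum R d _ N).
rewrite /flip_odd /=.
rewrite -signr_odd -[(-1) ^+ N.+2]signr_odd /= negbK base_prodS natrM.
have dN := digit_base_neq0 N; have DN := base_prodR_neq0 N.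
case: (odd N) => /=.
  by field; rewrite dN DN.
have /ltnSE eN : (e N.+1 < (d N.+1).-1.+1)%N.
  by have := he N.+1 isT; lia.
rewrite natrB// -subn1 natrB; last by have := hd N.+1 isT; lia.
by field; rewrite dN DN.
Qed.

Lemma cvg_parity_base_prodV :
  ((~~ odd n)%:R / (D n)%:R : R) @[n --> \oo] --> 0.
Proof.
apply: (@squeeze_cvgr _ _ _ _ (fun=> 0) (fun n => (D n)%:R^-1)); last 2 first.
- exact: cvg_cst.
- exact: cvg_base_prodV.
near=> n; rewrite divr_ge0//= ler_piMl ?invr_ge0//.
by rewrite lern1 leq_b1.
Unshelve. all: by end_near. Qed.

Lemma cvg_a0 :
  \sum_(1 <= n < N.+1) ((-1) ^+ n.+1 / (D n)%:R : R) @[N --> \oo] --> a0 R d.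
Proof.
(* For the zero digits the alternating sums vanish, and the reduction expresses
   the partial sums of a_0 by those of a convergent Cantor series. *)
pose z := fun _ : nat => 0%N.
have hz : digits d z by move=> n n1; have := hd n n1; rewrite /z; lia.
have hc := cvg_cantor_sum _ (digits_flip_odd z hz).
suff : \sum_(1 <= n < N.+1) ((-1) ^+ n.+1 / (D n)%:R : R) @[N --> \oo]
    --> 1 - 0 - cantor R d (flip_odd d z) by exact: cvgP.
rewrite [X in X @ _](_ : _ = fun N => 1 - (~~ odd N)%:R / (D N)%:R
    - cantor_sum R d (flip_odd d z) N).
  by apply: cvgB hc; apply: cvgB cvg_parity_base_prodV; exact: cvg_cst.
apply/funext => N; have := alternating_sum_flip z N hz.
rewrite [in X in X -> _]big1 => [|i _]; last by rewrite mulr0 mul0r.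
by move=> h; lra.
Qed.

Lemma nega_D_cantor e : digits d e ->
  nega_D R d e = a0 R d - 1 + cantor R d (flip_odd d e).
Proof.
move=> he; apply: cvg_lim => //.
under eq_cvg do rewrite alternating_sum_flip//.
rewrite -[a0 R d - 1]addr0.
apply: cvgD (cvg_cantor_sum _ (digits_flip_odd e he)).
by apply: cvgD cvg_parity_base_prodV; apply: cvgB; [exact: cvg_a0|exact: cvg_cst].
Qed.

(** The condition a_0 - 1 <= x <= a_0 holds automatically for represented
    numbers, since Cantor series have sums in [0, 1]. *)
Lemma Delta_set_cylinders k c : (c < d k.+1)%N ->
  Delta_set d k.+1 c =
  \bigcup_(j in `I_(D k)) cylinder R d k.+1 (flip_odd d (fun=> c) k.+1) (a0 R d - 1) j.
Proof.
move=> ck; set c' := flip_odd _ _ _.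
have ck' : (c' < d k.+1)%N by rewrite /c' /flip_odd; case: ifP; lia.
have cylinderE j x : cylinder R d k.+1 c' (a0 R d - 1) j x <->
    cylinder R d k.+1 c' 0 j (x - (a0 R d - 1)).
  rewrite /cylinder /= !in_itv /= !add0r.
  by rewrite lerBrDl lerBlDl.
have := cantor_digit_set _ _ ck'; rewrite -/c' => cantorE.
apply/seteqP; split => x.
  move=> [_ [e [he ek ->]]].
  have : [set x : R | exists e, [/\ digits d e, e k.+1 = c' & x = cantor R d e]]
      (nega_D R d e - (a0 R d - 1)).
    exists (flip_odd d e); split; first exact: digits_flip_odd.
      by rewrite /c' /flip_odd ek.
    by rewrite nega_D_cantor// addrAC subrr add0r.
  by rewrite cantorE => -[j jk /cylinderE]; exists j.
move=> [j jk /cylinderE xj].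
have : (\bigcup_(j in `I_(D k)) cylinder R d k.+1 c' 0 j) (x - (a0 R d - 1)).
  by exists j.
rewrite -cantorE => -[e [he ek xe]].
have xE : x = a0 R d - 1 + cantor R d e by rewrite -xe; ring.
have := cantor_enclosure e 0 he.
rewrite /cantor_sum big_geq// base_prod0 invr1 add0r => e01.
split; first by rewrite xE; lra.
exists (flip_odd d e); split; first exact: digits_flip_odd.
  by rewrite /flip_odd ek /c' /flip_odd; case: (odd k.+1); lia.
rewrite nega_D_cantor; last exact: digits_flip_odd.
by rewrite flip_oddK.
Qed.

(** * Measure of the cylinders *)

Lemma measurable_cylinder k c a j :
  measurable (cylinder R d k c a j : set (measurableTypeR R)).
Proof. exact: measurable_itv. Qed.

Lemma lebesgue_measure_cylinder k c a j :
  lebesgue_measure (cylinder R d k c a j : set (measurableTypeR R))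
  = ((D k)%:R^-1 : R)%:E.
Proof.
rewrite /cylinder /= lebesgue_measure_itv /= lte_fin.
have Dk := base_prodR_gt0 k.
rewrite ltrD2l ltr_pM2r ?invr_gt0// ltr_nat ltnSn -EFinB; congr EFin.
by rewrite -natr1; ring.
Qed.

(** Distinct left endpoints differ by at least d_(k+1) / D_(k+1), while the
    length is 1 / D_(k+1) and d_(k+1) >= 2. *)
Lemma trivIset_cylinder k c a : trivIset setT (cylinder R d k.+1 c a).
Proof.
move=> i j _ _ [x []]; rewrite /cylinder /= !in_itv /= => /andP[ix xi] /andP[jx xj].
have D_gt0 := base_prodR_gt0 k.+1.
have := le_trans ix xj; have := le_trans jx xi.
rewrite !lerD2l !ler_pM2r ?invr_gt0// !ler_nat.
by have := hd k.+1 isT; nia.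
Qed.

End CantorSeries.

Theorem lemma17 (R : realType) (d : nat -> nat)
  (hd : forall n : nat, (1 <= n)%N -> (2 <= d n)%N)
  (k c : nat) (hk : (1 <= k)%N) (hc : (c < d k)%N) :
  measurable (Delta_set d k c : set (measurableTypeR R)) /\
  lebesgue_measure (Delta_set d k c : set (measurableTypeR R))
    = ((d k)%:R^-1 : R)%:E.
Proof.
case: k hk hc => // k _ ck.
rewrite (Delta_set_cylinders R d hd k c ck) bigcup_mkord.
split.
  by apply: bigsetU_measurable => j _; exact: measurable_cylinder.
rewrite measure_bigsetU; last 2 first.
- by move=> j; exact: measurable_cylinder.
- exact: trivIset_cylinder.
rewrite (eq_bigr (fun=> ((base_prod d k.+1)%:R^-1 : R)%:E)) => [|j _]; last first.
  exact: lebesgue_measure_cylinder.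
rewrite sumEFin sumr_const card_ord; congr EFin.
rewrite base_prodS natrM invfM -mulrnAl -mulr_natr mulVf ?mul1r//.
exact: base_prodR_neq0.
Qed.
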